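(* Let $(X_t)_{t\in\mathbb{Z}}$ be a centered strictly stationary process with finite second moments satisfying $X_t-\phi X_{t-1}=Z_t$ for every $t\in\mathbb{Z}$, where $\phi=e^{-H}$ for some $H>0$ and $(Z_t)_{t\in\mathbb{Z}}$ is a strictly stationary process. Let $\gamma(n)=\operatorname{cov}(X_t,X_{t+n})$, $r(n)=\operatorname{cov}(Z_t,Z_{t+n})$, and let $N\in\mathbb{N}$ be fixed. Let $\hat\gamma_T(N+1)$, $\hat\gamma_T(N-1)$ be estimators of $\gamma(N+1)$, $\gamma(N-1)$ based on observations $(X_1,\ldots,X_T)$. Define $\hat\phi_T$ as the truncation to $[0,1]$ of $$-\frac{r(N)}{\hat\gamma_T(N+1)+\hat\gamma_T(N-1)}\,\mathbf{1}_{\{\hat\gamma_T(N+1)+\hat\gamma_T(N-1)\neq0\}}.$$ Assume that $\gamma(N)=0$ and $r(N)\neq0$. If the vector-valued estimator $[\hat\gamma_T(N+1),\hat\gamma_T(N-1)]^\top$ is consistent (for $[\gamma(N+1),\gamma(N-1)]^\top$), then $\hat\phi_T$ is consistent (for $\phi$).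
   Context: All processes are real-valued. A process $X=(X_t)_{t\in\mathbb{Z}}$ is strictly stationary if $(X_{t+n_1},\ldots,X_{t+n_k})$ and $(X_{n_1},\ldots,X_{n_k})$ have the same law for all $k\in\mathbb{N}$ and $t,n_1,\ldots,n_k\in\mathbb{Z}$. Centered means $\mathbb{E}(X_t)=0$ for every $t$. Consistency means convergence in probability to the true value as $T\to\infty$. The truncation to $[0,1]$ of a real number $y$ is $y$ if $y\in[0,1]$, $0$ if $y<0$, and $1$ if $y>1$. The expression with the indicator is $0$ when the indicator is $0$. The estimators $\hat\gamma_T(n)$ are arbitrary real-valued random variables (functions of the observations); no specific form is assumed. *)

(* Defs.v *)
From HB Require Import structures.
From mathcomp Require Import all_boot all_order all_algebra.
From mathcomp Require Import all_classical all_reals all_analysis.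

Set Implicit Arguments.
Unset Strict Implicit.
Unset Printing Implicit Defensive.

Import Order.TTheory GRing.Theory Num.Theory.
Import numFieldNormedType.Exports.

Local Open Scope classical_set_scope.
Local Open Scope ring_scope.

Section processes.
Context d (Omega : measurableType d) (R : realType) (P : probability Omega R).

(* Laws are compared on measurable sets only: a measure has arbitrary values on
   the other ones.  [k.-tuple R] carries the product sigma-algebra. *)
Definition strictly_stationary (X : int -> Omega -> R) : Prop :=
  forall (k : nat) (n : 'I_k -> int) (t : int) (A : set (k.-tuple R)),
    measurable A ->
    pushforward P (fun w => [tuple X (t + n i) w | i < k]) A =
    pushforward P (fun w => [tuple X (n i) w | i < k]) A.

(* cov(X_t, X_(t+n)), taken at t = 0: for a strictly stationary process with
   finite second moments it is finite and does not depend on t. *)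
Definition autocovariance (X : int -> Omega -> R) (n : int) : R :=
  fine (covariance P (X 0) (X n)).

(* The sample (X_1, ..., X_T). *)
Definition observations (X : int -> Omega -> R) (T : nat) (w : Omega) :
  T.-tuple R := [tuple X i.+1%:Z w | i < T].

(* Convergence in probability of [est T] to [theta] as T tends to infinity.  On
   column vectors the norm is the maximum of the moduli of the entries. *)
Definition consistent (V : normedModType R) (est : nat -> Omega -> V)
    (theta : V) : Prop :=
  forall eps : R, 0 < eps ->
    P [set w | eps < `|est T w - theta|] @[T --> \oo] --> 0%E.

End processes.

Definition truncate01 (R : realType) (y : R) : R :=
  if y < 0 then 0 else if 1 < y then 1 else y.

Definition vec2 (R : realType) (a b : R) : 'cV[R]_2 :=
  \col_(i < 2) if i == 0 then a else b.

(* [a] and [b] stand for the estimates of gamma(N+1) and gamma(N-1), and [rN]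
   for r(N). *)
Definition phi_estimate (R : realType) (rN a b : R) : R :=
  truncate01 (- (rN / (a + b)) * (a + b != 0)%:R).

(* Main.v *)
(* Expanding cov(X_0 - phi X_(-1), X_N - phi X_(N-1)) by stationarity gives
     r(N) = (1 + phi^2) gamma(N) - phi (gamma(N+1) + gamma(N-1)).
   As gamma(N) = 0 and r(N) <> 0, the sum s = gamma(N+1) + gamma(N-1) is nonzero
   and phi = - r(N) / s.  The map s' |-> - r(N) / s' is continuous at s, and
   truncation to [0,1] does not increase the distance to phi, so phi_hat is far
   from phi only where the estimated vector is far from its target. *)
Require Import Defs.
From HB Require Import structures.
From mathcomp Require Import all_boot all_order all_algebra.
From mathcomp Require Import all_classical all_reals all_analysis.
From mathcomp Require Import measurable_realfun ring lra.
Import Order.TTheory GRing.Theory Num.Theory.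
Import numFieldNormedType.Exports.
Local Open Scope classical_set_scope.
Local Open Scope ring_scope.

(** * Measurability of the estimator and of the observed sample *)

Lemma measurable_funV (d : measure_display) (T : measurableType d)
    (R : realType) (D : set T) (f : T -> R) :
  measurable_fun D f -> measurable_fun D (fun x => (f x)^-1).
Proof.
(* Real powers are known to be measurable, but only on nonnegative bases do they
   agree with the inverse. *)
move=> mf; apply: (eq_measurable_fun (fun x => f x * (f x ^+ 2) `^ (-1))).
  move=> x _ /=; rewrite powR_inv1 ?sqr_ge0//.
  have [->|f0] := eqVneq (f x) 0; first by rewrite invr0 mul0r.
  by rewrite expr2 invfM mulrA divff// mul1r.
apply: measurable_funM => //.
apply: (@measurableT_comp _ _ _ _ _ _ (@powR R ^~ (-1)) D) => //.
exact: measurable_funX.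
Qed.

Lemma measurable_truncate01 (R : realType) :
  measurable_fun [set: R] (@truncate01 R).
Proof.
apply: measurable_fun_ifT => //; first exact: measurable_fun_ltr.
by apply: measurable_fun_ifT => //; exact: measurable_fun_ltr.
Qed.

(** Monotonicity of [P] applies to measurable events only, so the event of a large error of the
    estimator has to be shown measurable. *)
Lemma measurable_phi_estimate (d : measure_display) (T : measurableType d)
    (R : realType) (rN : R) (a b : T -> R) :
  measurable_fun [set: T] a -> measurable_fun [set: T] b ->
  measurable_fun [set: T] (fun x => phi_estimate rN (a x) (b x)).
Proof.
move=> ma mb; have mab := measurable_funD ma mb.
apply: (measurableT_comp (measurable_truncate01 R)) => /=.
apply: measurable_funM.
  apply: measurable_funN; apply: measurable_funM => //.
  exact: measurable_funV.
apply: (eq_measurable_fun (fun x => if a x + b x == 0 then 0 else 1 : R)).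
  by move=> x _ /=; case: eqP.
by apply: measurable_fun_ifT => //; exact: measurable_fun_eqr.
Qed.

Lemma measurable_observations (d : measure_display) (T : measurableType d)
    (R : realType) (P : probability T R) (X : int -> {RV P >-> R}) (n : nat) :
  measurable_fun [set: T] (observations X n).
Proof.
apply/measurable_fun_tnthP => i.
apply: (eq_measurable_fun (X i.+1%:Z)) => // w _.
by rewrite /= tnth_mktuple.
Qed.

(** * Estimation errors and the events on which they are large *)

Lemma truncate01_dist_le (R : realType) (x y : R) :
  0 <= x <= 1 -> `|truncate01 y - x| <= `|y - x|.
Proof.
move=> /andP[x0 x1]; rewrite /truncate01.
case: ltP => y0; last case: ltP => y1 //.
  by rewrite !ler0_norm; lra.
by rewrite !ger0_norm; lra.
Qed.

(** The bound [delta] does not depend on [a'] and [b'], hence serves all sample sizes and outcomes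
    at once. Its non-strict inequalities are the negations of the strict ones in [consistent]. *)
Lemma phi_estimate_continuous (R : realType) (rN a b : R) :
  a + b != 0 -> 0 <= - (rN / (a + b)) <= 1 ->
  forall eps : R, 0 < eps -> exists2 delta : R, 0 < delta &
    forall a' b', `|a' - a| <= delta -> `|b' - b| <= delta ->
      `|phi_estimate rN a' b' - - (rN / (a + b))| <= eps.
Proof.
move=> s0 phi01 eps eps0.
have : (fun s => - (rN / s)) s @[s --> a + b] --> - (rN / (a + b)).
  by apply: cvgN; apply: cvgMr; exact: cvgV.
move=> /cvgrPdist_le /(_ _ eps0).
(* Near [a + b] the indicator equals 1, so the default value 0 of the estimator does not occur. *)
have : \forall s \near a + b, s != 0.
  exact: (cvgr_neq0 (f := id) (a + b) cvg_id s0).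
move=> /nbhs_ballP[e1 /= e10 nz] /nbhs_ballP[e2 /= e20 cl].
(* Two deviations of at most a quarter of the minimum move the sum by at most half of it, strictly
   inside both balls. *)
exists (Num.min e1 e2 / 4).
  by rewrite divr_gt0// lt_min e10 e20.
move=> a' b' aa bb.
have dist : `|a + b - (a' + b')| < Num.min e1 e2.
  have m0 : 0 < Num.min e1 e2 by rewrite lt_min e10 e20.
  rewrite distrC opprD addrACA (le_lt_trans (ler_normD _ _))//.
  by rewrite (le_lt_trans (lerD aa bb))//; lra.
have [d1 d2] : `|a + b - (a' + b')| < e1 /\ `|a + b - (a' + b')| < e2.
  by apply/andP; rewrite -lt_min.
have nz' := nz _ d1; have cl' := cl _ d2.
rewrite /phi_estimate nz' mulr1.
by rewrite (le_trans (truncate01_dist_le _ _ _ phi01))// distrC.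
Qed.

(** The norm is a maximum with base value 0; for nonnegative [e], being at most [e] is therefore a
    condition on the entries alone. *)
Lemma vec2_dist_gt (R : realType) (a b a' b' e : R) : 0 <= e ->
  (e < `|vec2 a' b' - vec2 a b|) = (e < `|a' - a|) || (e < `|b' - b|).
Proof.
move=> e0; rewrite !ltNge -negb_and; congr negb.
rewrite [X in (X <= _)]/Num.Def.normr /= mx_normrE; apply/bigmax_leP/andP.
  move=> [_ h]; split.
    by have := h (ord0, ord0) isT; rewrite !mxE.
  by have := h (ord_max, ord0) isT; rewrite !mxE.
move=> [aa bb]; split => // -[i j] _ /=; rewrite !mxE.
by case: ifP.
Qed.

Lemma measurable_dist_gt (d : measure_display) (T : measurableType d)
    (R : realType) (f : T -> R) (theta e : R) :
  measurable_fun [set: T] f -> measurable [set x | e < `|f x - theta|].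
Proof.
move=> mf; have mg : measurable_fun [set: T] (fun x => e < `|f x - theta|).
  apply: measurable_fun_ltr => //; apply: measurableT_comp => //.
  exact: measurable_funB.
by rewrite -[X in measurable X]setTI; exact: (mg measurableT [set true]).
Qed.

(** * Second moments and covariances under stationarity *)

Lemma Lfun2_of_sqr_expectation (d : measure_display) (T : measurableType d)
    (R : realType) (P : probability T R) (X : {RV P >-> R}) :
  ('E_P[fun w => (X w ^+ 2)%R] < +oo)%E -> (X : T -> R) \in Lfun P 2%:E.
Proof.
rewrite unlock => X2; apply/andP; split; rewrite inE//=.
(* The norm is a power of the integral of the squared modulus, so it is finite once this integral
   is; the real exponent 2 then becomes an ordinary square. *)
rewrite /finite_norm unlock /Lnorm poweR_lty//.
under eq_integral do rewrite /= powR_mulrn// real_normK ?num_real//.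
by [].
Qed.

Lemma ae_eq_expectation (d : measure_display) (T : measurableType d)
    (R : realType) (P : probability T R) (X Y : T -> R) :
  measurable_fun [set: T] X -> measurable_fun [set: T] Y ->
  {ae P, forall w, X w = Y w} -> ('E_P[X] = 'E_P[Y])%E.
Proof.
move=> mX mY XY; rewrite unlock; apply: ae_eq_integral => //.
- exact/measurable_EFinP.
- exact/measurable_EFinP.
- by apply: filterS XY => w -> _.
Qed.

(** The recursion holds only almost surely; this still allows [Z t] to be replaced by
    [X t - phi * X (t - 1)] inside covariances. *)
Lemma ae_eq_covariance (d : measure_display) (T : measurableType d)
    (R : realType) (P : probability T R) (X X' Y Y' : T -> R) :
  measurable_fun [set: T] X -> measurable_fun [set: T] X' ->
  measurable_fun [set: T] Y -> measurable_fun [set: T] Y' ->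
  {ae P, forall w, X w = X' w} -> {ae P, forall w, Y w = Y' w} ->
  covariance P X Y = covariance P X' Y'.
Proof.
move=> mX mX' mY mY' XX' YY'; rewrite unlock.
rewrite (ae_eq_expectation _ _ _ _ _ _ mX mX' XX').
rewrite (ae_eq_expectation _ _ _ _ _ _ mY mY' YY').
apply: ae_eq_expectation.
- by apply: measurable_funM; exact: measurable_funB.
- by apply: measurable_funM; exact: measurable_funB.
- by apply: filterS2 XX' YY' => w /= Xw Yw; rewrite !fctE/= Xw Yw.
Qed.

(** By change of variables both sides are integrals of [f] against the laws of [U] and [V], and such
    integrals see a law only through measurable sets. *)
Lemma eq_law_expectation (d d' : measure_display) (T : measurableType d)
    (T' : measurableType d') (R : realType) (P : probability T R)
    (U V : T -> T') (f : T' -> R) :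
  measurable_fun [set: T] U -> measurable_fun [set: T] V ->
  measurable_fun [set: T'] f ->
  (forall A, measurable A -> pushforward P U A = pushforward P V A) ->
  f \o U \in Lfun P 1 -> f \o V \in Lfun P 1 ->
  ('E_P[f \o U] = 'E_P[f \o V])%E.
Proof.
move=> mU mV mf UV /Lfun1_integrable iU /Lfun1_integrable iV; rewrite unlock.
have mf' : measurable_fun [set: T'] (EFin \o f) by exact/measurable_EFinP.
pose U' : {mfun T >-> T'} := MeasurableFun.Pack
  (MeasurableFun.Class (isMeasurableFun.Build _ _ _ _ _ mU)).
pose V' : {mfun T >-> T'} := MeasurableFun.Pack
  (MeasurableFun.Class (isMeasurableFun.Build _ _ _ _ _ mV)).
rewrite -[LHS](integral_distribution (X := U') mf' iU).
rewrite -[RHS](integral_distribution (X := V') mf' iV).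
by apply: eq_measure_integral => A mA _; exact: UV.
Qed.

(** The product is a measurable function of a pair, and the pairs at times [(s, t)] and
    [(h + s, h + t)] have the same law. *)
Lemma stationary_expectationM (d : measure_display) (T : measurableType d)
    (R : realType) (P : probability T R) (X : int -> {RV P >-> R})
    (h s t : int) :
  strictly_stationary P X ->
  (forall u, (X u : T -> R) \in Lfun P 2%:E) ->
  ('E_P[(X (h + s) \* X (h + t))%R] = 'E_P[(X s \* X t)%R])%E.
Proof.
move=> statX X2.
pose n (i : 'I_2) := if i == ord0 then s else t.
pose f (v : 2.-tuple R) := tnth v ord0 * tnth v ord_max.
pose U k (w : T) : 2.-tuple R := [tuple X (k + n i) w | i < 2].
have fU k : f \o U k = X (k + s) \* X (k + t).
  by apply/funext => w; rewrite /f /= !tnth_mktuple.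
have mU k : measurable_fun [set: T] (U k).
  apply/measurable_fun_tnthP => i.
  apply: (eq_measurable_fun (X (k + n i))) => // w _.
  by rewrite /= tnth_mktuple.
have lU k : f \o U k \in Lfun P 1 by rewrite fU; exact: Lfun2_mul_Lfun1.
have -> : X s \* X t = f \o U 0 by rewrite fU !add0r.
rewrite -fU; apply: eq_law_expectation => //.
- by apply: measurable_funM; exact: measurable_tnth.
- move=> A mA; rewrite statX//.
  by congr (pushforward P _ A); apply/funext => w; apply: eq_mktuple => i;
     rewrite add0r.
Qed.

Lemma centered_covarianceE (d : measure_display) (T : measurableType d)
    (R : realType) (P : probability T R) (X Y : T -> R) :
  ('E_P[X] = 0)%E -> ('E_P[Y] = 0)%E -> covariance P X Y = ('E_P[(X \* Y)%R])%E.
Proof.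
move=> X0 Y0; rewrite unlock X0 Y0; congr expectation.
by apply/funext => w; rewrite !fctE/= !subr0.
Qed.

Lemma autoregression_autocovariance (d : measure_display)
    (T : measurableType d) (R : realType) (P : probability T R)
    (X Z : int -> {RV P >-> R}) (phi : R) (n : int) :
  strictly_stationary P X ->
  (forall t : int, ('E_P[X t] = 0)%E) ->
  (forall t : int, ('E_P[fun w => (X t w ^+ 2)%R] < +oo)%E) ->
  (forall t : int, {ae P, forall w, X t w - phi * X (t - 1) w = Z t w}) ->
  autocovariance P Z n = (1 + phi ^+ 2) * autocovariance P X n
    - phi * (autocovariance P X (n + 1) + autocovariance P X (n - 1)).
Proof.
move=> statX X0 Xsqr XZ.
have X2 u : (X u : T -> R) \in Lfun P 2%:E by exact: Lfun2_of_sqr_expectation.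
have X1 u : (X u : T -> R) \in Lfun P 1.
  by apply: Lfun_subset12 (X2 u); rewrite fin_num_measure.
have XX1 u v : (X u : T -> R) * X v \in Lfun P 1 by exact: Lfun2_mul_Lfun1.
have pX2 u : phi \o* (X u : T -> R) \in Lfun P 2%:E.
  by apply: Lfun_scale => //; rewrite ler1n.
have pX1 u : phi \o* (X u : T -> R) \in Lfun P 1 by exact: Lfun_scale.
have covX h s t : covariance P (X (h + s)) (X (h + t)) = covariance P (X s) (X t).
  by rewrite !centered_covarianceE// stationary_expectationM.
(* The times [(s, t)] are the shift by [s] of [(0, t - s)]. Square integrability makes the
   covariance finite, so [fine] loses nothing. *)
have covE s t : covariance P (X s) (X t) = (autocovariance P X (t - s))%:E.
  rewrite /autocovariance fineK ?covariance_fin_num//.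
  by rewrite -(covX s 0 (t - s)) addr0 addrC subrK.
have mZ u : measurable_fun [set: T] (X u \- phi \o* (X (u - 1) : T -> R)).
  by apply: measurable_funB => //; apply: measurable_funM.
have eqZ u : {ae P, forall w,
    Z u w = (X u \- phi \o* (X (u - 1) : T -> R)) w}.
  by apply: filterS (XZ u) => w <- /=; rewrite [_ * phi]mulrC.
rewrite {1}/autocovariance.
rewrite (ae_eq_covariance _ _ _ _ _ _ _ _ _ (mZ 0) _ (mZ n) (eqZ 0) (eqZ n))//.
have dX2 u : X u \- phi \o* (X (u - 1) : T -> R) \in Lfun P 2%:E.
  by rewrite rpredB ?lee1n.
rewrite covarianceBl// !covarianceBr//.
rewrite !covarianceZl// ?covarianceZr//; last exact: Lfun2_mul_Lfun1.
(* Pairing the times 0 and -1 with [n] and [n - 1] gives the lags [n], [n - 1], [n + 1] and again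
   [n]. *)
by rewrite !covE/= !subr0 sub0r opprK subrK; ring.
Qed.

(** * From the covariance identity to convergence in probability *)

Theorem theorem3 (d : measure_display) (Omega : measurableType d)
    (R : realType) (P : probability Omega R)
    (X Z : int -> {RV P >-> R}) (phi H : R) (N : nat)
    (gamma_hat : forall T : nat, int -> {mfun T.-tuple R >-> R}) :
  let gamma := autocovariance P X in
  let r := autocovariance P Z in
  let gamma_est (n : int) (T : nat) (w : Omega) : R :=
    gamma_hat T n (observations X T w) in
  let phi_hat (T : nat) (w : Omega) : R :=
    phi_estimate (r N%:Z) (gamma_est (N%:Z + 1) T w)
                          (gamma_est (N%:Z - 1) T w) in
  strictly_stationary P X ->
  (forall t : int, ('E_P[X t] = 0)%E) ->
  (forall t : int, ('E_P[fun w => (X t w ^+ 2)%R] < +oo)%E) ->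
  strictly_stationary P Z ->
  0 < H ->
  phi = expR (- H) ->
  (forall t : int, {ae P, forall w, X t w - phi * X (t - 1) w = Z t w}) ->
  gamma N%:Z = 0 ->
  r N%:Z != 0 ->
  consistent P (fun T w => vec2 (gamma_est (N%:Z + 1) T w)
                                (gamma_est (N%:Z - 1) T w))
               (vec2 (gamma (N%:Z + 1)) (gamma (N%:Z - 1))) ->
  consistent P phi_hat phi.
Proof.
move=> gamma r gamma_est phi_hat statX X0 Xsqr _ H0 phiE XZ gN rN cons.
have phi_gt0 : 0 < phi by rewrite phiE expR_gt0.
have phi_lt1 : phi < 1 by rewrite phiE expR_lt1 oppr_lt0.
have rE : r N%:Z = - (phi * (gamma (N%:Z + 1) + gamma (N%:Z - 1))).
  rewrite /r (autoregression_autocovariance _ _ _ _ _ _ _ _ statX X0 Xsqr XZ).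
  by rewrite -/gamma gN mulr0 sub0r.
have s0 : gamma (N%:Z + 1) + gamma (N%:Z - 1) != 0.
  by apply: contraNneq rN => s0; rewrite rE s0 mulr0 oppr0.
have phiE' : - (r N%:Z / (gamma (N%:Z + 1) + gamma (N%:Z - 1))) = phi.
  by rewrite rE mulNr opprK mulfK.
have mest n k : measurable_fun [set: Omega] (gamma_est n k).
  by apply: (measurableT_comp (f := gamma_hat k n)) => //;
     exact: measurable_observations.
move=> eps eps0.
have phi01 : 0 <= - (r N%:Z / (gamma (N%:Z + 1) + gamma (N%:Z - 1))) <= 1.
  by rewrite phiE' !ltW.
have [delta delta0 close] := phi_estimate_continuous _ _ _ _ s0 phi01 _ eps0.
rewrite phiE' in close.
apply: squeeze_cvge (cvg_cst 0%E) (cons _ delta0).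
(* For each sample size the event of a large error of [phi_hat] lies in the event of a [delta]-large
   error of the vector, whose probability tends to 0. *)
apply: nearW => k; rewrite measure_ge0/=; apply: le_measure.
- rewrite inE; apply: measurable_dist_gt; exact: measurable_phi_estimate.
- rewrite inE [X in measurable X](_ : _ =
      [set w | delta < `|gamma_est (N%:Z + 1) k w - gamma (N%:Z + 1)|] `|`
      [set w | delta < `|gamma_est (N%:Z - 1) k w - gamma (N%:Z - 1)|]).
    by apply: measurableU; exact: measurable_dist_gt.
  by apply/seteqP; split => w /=; rewrite vec2_dist_gt ?ltW// => /orP.
(* By contraposition: off the vector event both entries are within [delta] of their targets, where
   [close] applies. *)
- move=> w /=; apply: contraTT; rewrite vec2_dist_gt ?ltW// negb_or -!leNgt.
  by case/andP; exact: close.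
Qed.
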